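(* Two different two-qubit pure states $|\psi\rangle$ and $|\psi'\rangle$ have the same optimal CHSH operator if and only if they can be written as $$|\psi\rangle=(U_A\otimes U_B)(\cos\theta|00\rangle+\sin\theta|11\rangle),\qquad |\psi'\rangle=(U_A\otimes U_B)(\sin\theta|00\rangle+\cos\theta|11\rangle)$$ for some unitaries $U_A,U_B$ on $\mathbb{C}^2$ and some $\theta\in[0,\pi)$. In that case the operators $(U_A\otimes U_B)S_{\theta+}(U_A\otimes U_B)^\dagger$ and $(U_A\otimes U_B)S_{\theta-}(U_A\otimes U_B)^\dagger$ are optimal CHSH operators for both $|\psi\rangle$ and $|\psi'\rangle$, where $$S_{\theta+}=\frac{2}{\sqrt{1+\sin^2 2\theta}}\big(\sin 2\theta\,\sigma_x\otimes\sigma_x+\sigma_z\otimes\sigma_z\big),\quad S_{\theta-}=\frac{2}{\sqrt{1+\sin^2 2\theta}}\big(-\sin 2\theta\,\sigma_y\otimes\sigma_y+\sigma_z\otimes\sigma_z\big).$$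
   Context: $\sigma_x,\sigma_y,\sigma_z$ are the Pauli matrices, $\vec\sigma=(\sigma_x,\sigma_y,\sigma_z)$. A CHSH operator is an operator $S=A\otimes(B+B')+A'\otimes(B-B')$ with $A=\vec a\cdot\vec\sigma$, $A'=\vec a'\cdot\vec\sigma$, $B=\vec b\cdot\vec\sigma$, $B'=\vec b'\cdot\vec\sigma$ for unit vectors $\vec a,\vec a',\vec b,\vec b'\in\mathbb{R}^3$. The nonlocality of a two-qubit state $\rho$ is $\mathcal{N}(\rho)=\max_S\mathrm{tr}(\rho S)$ over all CHSH operators; $S$ is an optimal CHSH operator of $\rho$ if $\mathrm{tr}(\rho S)=\mathcal{N}(\rho)$. Two states have the same optimal CHSH operator if some CHSH operator is optimal for both. *)

(* Defs.v *)
From HB Require Import structures.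
From mathcomp Require Import all_boot all_order all_algebra.
From mathcomp Require Import complex mxtens.
From mathcomp Require Import reals trigo.

Set Implicit Arguments.
Unset Strict Implicit.
Unset Printing Implicit Defensive.

Import Order.TTheory GRing.Theory Num.Theory.
Local Open Scope ring_scope.
Local Open Scope complex_scope.

Section QubitDefs.
Variable R : realType.
Local Notation C := R[i].

Definition adj {m n : nat} (M : 'M[C]_(m, n)) : 'M[C]_(n, m) := (map_mx (@conjc R) M)^T.

Definition sigma_x : 'M[C]_2 := \matrix_(i < 2, j < 2) (if i == j then 0 else 1).
Definition sigma_y : 'M[C]_2 :=
  \matrix_(i < 2, j < 2) (if i == j then 0 else if (i : nat) == 0%N then - 'i else 'i).
Definition sigma_z : 'M[C]_2 :=
  \matrix_(i < 2, j < 2) (if i == j then (if (i : nat) == 0%N then 1 else -1) else 0).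

Definition sigma (k : 'I_3) : 'M[C]_2 :=
  if (k : nat) == 0%N then sigma_x else if (k : nat) == 1%N then sigma_y else sigma_z.

Definition unit3 (a : 'rV[R]_3) : Prop := \sum_(k < 3) a 0 k ^+ 2 = 1.

Definition dot_sigma (a : 'rV[R]_3) : 'M[C]_2 := \sum_(k < 3) (a 0 k)%:C *: sigma k.

Definition is_CHSH (S : 'M[C]_4) : Prop :=
  exists a a' b b' : 'rV[R]_3,
    [/\ unit3 a, unit3 a', unit3 b, unit3 b' &
      S = dot_sigma a *t (dot_sigma b + dot_sigma b')
          + dot_sigma a' *t (dot_sigma b - dot_sigma b')].

Definition optimal_CHSH (rho S : 'M[C]_4) : Prop :=
  is_CHSH S /\ forall S' : 'M[C]_4, is_CHSH S' -> \tr (rho *m S') <= \tr (rho *m S).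

Definition same_optimal_CHSH (rho rho' : 'M[C]_4) : Prop :=
  exists S : 'M[C]_4, optimal_CHSH rho S /\ optimal_CHSH rho' S.

Definition unit_vec (psi : 'cV[C]_4) : Prop := adj psi *m psi = 1%:M.
Definition proj (psi : 'cV[C]_4) : 'M[C]_4 := psi *m adj psi.

Definition unitary2 (U : 'M[C]_2) : Prop := U *m adj U = 1%:M.

Definition ket0 : 'cV[C]_2 := delta_mx 0 0.
Definition ket1 : 'cV[C]_2 := delta_mx 1 0.
Definition ket00 : 'cV[C]_4 := ket0 *t ket0.
Definition ket11 : 'cV[C]_4 := ket1 *t ket1.

Definition phi_cs (t : R) : 'cV[C]_4 := (cos t)%:C *: ket00 + (sin t)%:C *: ket11.
Definition phi_sc (t : R) : 'cV[C]_4 := (sin t)%:C *: ket00 + (cos t)%:C *: ket11.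

Definition S_plus (t : R) : 'M[C]_4 :=
  (2 / Num.sqrt (1 + sin (2 * t) ^+ 2))%:C *:
    ((sin (2 * t))%:C *: (sigma_x *t sigma_x) + sigma_z *t sigma_z).
Definition S_minus (t : R) : 'M[C]_4 :=
  (2 / Num.sqrt (1 + sin (2 * t) ^+ 2))%:C *:
    (- (sin (2 * t))%:C *: (sigma_y *t sigma_y) + sigma_z *t sigma_z).

End QubitDefs.

(* Main.v *)
Require Import Defs.
From HB Require Import structures.
From mathcomp Require Import all_boot all_order all_algebra.
From mathcomp Require Import complex mxtens spectral.
From mathcomp Require Import reals trigo.
From mathcomp Require Import ring lra.

Import Order.TTheory GRing.Theory Num.Theory.
Local Open Scope ring_scope.
Local Open Scope complex_scope.

(** Write a state as a two-by-two matrix [X], so that [A *t B] acts by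
    [X |-> A X B^T] and the concurrence [c := 2 |det X|] is invariant under
    local unitaries.  A CHSH operator is a real bilinear form of rank at most
    two and squared Frobenius norm 4 in the Pauli matrices; a singular value
    decomposition, lifted to local unitaries, brings it to the form
    [D_s := 2 / sqrt (1 + s^2) * (s sigma_x sigma_x + sigma_z sigma_z)] with
    [0 <= s <= 1].  Its mean value in [X] is at most
    [2 (1 + s c) / sqrt (1 + s^2) <= 2 sqrt (1 + c^2)], and the last bound is
    attained by some CHSH operator, by the Schmidt decomposition of [X].  Hence
    [D_s] is optimal for [X] only if both inequalities are equalities, which
    forces [c = s] and leaves exactly the two states
    [cos t |00> + sin t |11>] and [sin t |00> + cos t |11>], [sin 2t = s].
    The case of [S_minus] follows from that of [S_plus] by the local phase
    gates [diag (1, i)] and [diag (1, -i)], which fix these states. *)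

Section CHSH.
Set Implicit Arguments.
Unset Strict Implicit.
Variable R : realType.
Local Notation C := R[i].
Implicit Types (A B U V X Y : 'M[C]_2) (psi : 'cV[C]_4) (S : 'M[C]_4) (s t : R).
Implicit Types (a b p q u w : 'rV[R]_3).

(** * Coordinates *)

Lemma ord2P (i : 'I_2) : i = 0 \/ i = 1.
Proof. by case: i => [[|[|//]] hi]; [left|right]; apply/val_inj. Qed.

Lemma sum2 (V : nmodType) (F : 'I_2 -> V) : \sum_i F i = F 0 + F 1.
Proof. by rewrite big_ord_recl big_ord1; congr (_ + F _); apply/val_inj. Qed.

Lemma sum3 (V : nmodType) (F : 'I_3 -> V) : \sum_i F i = F 0 + F 1 + F 2.
Proof.
rewrite !big_ord_recl big_ord0 addr0 addrA.
by congr (_ + F _ + F _); apply/val_inj.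
Qed.

Lemma mx2P X Y : X 0 0 = Y 0 0 -> X 0 1 = Y 0 1 -> X 1 0 = Y 1 0 ->
  X 1 1 = Y 1 1 -> X = Y.
Proof.
move=> h00 h01 h10 h11; apply/matrixP=> i j.
by case: (ord2P i) (ord2P j) => -> [] ->.
Qed.

Lemma row2P (u v : 'rV[C]_2) : u 0 0 = v 0 0 -> u 0 1 = v 0 1 -> u = v.
Proof. by move=> h0 h1; apply/rowP => i; case: (ord2P i) => ->. Qed.

Lemma complexP (x y : C) : complex.Re x = complex.Re y -> complex.Im x = complex.Im y -> x = y.
Proof. by case: x y => a b [c d] /= -> ->. Qed.

(** The squared modulus, valued in [R] rather than in [C], so that estimates become real arithmetic
    for [lra] and [nra]. *)
Definition sqn (z : C) : R := complex.Re z ^+ 2 + complex.Im z ^+ 2.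
(** The real part of [z * w^*], that is, the scalar product of [z] and [w] seen as vectors of the
    real plane. *)
Definition dotc (z w : C) : R :=
  complex.Re z * complex.Re w + complex.Im z * complex.Im w.

Lemma sqn_ge0 (z : C) : 0 <= sqn z.
Proof. by rewrite addr_ge0 ?sqr_ge0. Qed.

Lemma sqn_eq0 (z : C) : sqn z = 0 -> z = 0.
Proof.
case: z => a b /eqP; rewrite /sqn /= paddr_eq0 ?sqr_ge0 // !sqrf_eq0.
by case/andP=> /eqP-> /eqP->.
Qed.

Lemma mulc_conj (z : C) : z * z^* = (sqn z)%:C.
Proof. by case: z => a b; apply: complexP; rewrite /sqn /=; ring. Qed.

Lemma sqn_real (p : R) : sqn (p%:C : C) = p ^+ 2.
Proof. by rewrite /sqn /= expr0n addr0. Qed.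

Lemma normc_ge0 (z : C) : 0 <= Normc.normc z.
Proof. by case: z => a b; rewrite sqrtr_ge0. Qed.

Lemma sqnE (z : C) : sqn z = Normc.normc z ^+ 2.
Proof. by case: z => a b; rewrite /= sqr_sqrtr // addr_ge0 ?sqr_ge0. Qed.

Lemma dotc_le (z w : C) : dotc z w <= Normc.normc z * Normc.normc w.
Proof.
case: z w => a b [c d]; rewrite /dotc /=.
rewrite -sqrtrM ?addr_ge0 ?sqr_ge0 //.
apply: le_trans (ler_norm _) _; rewrite -sqrtr_sqr; apply: ler_wsqrtr.
(* Lagrange's identity: the defect in Cauchy-Schwarz is the square of the imaginary part of
   [z * w^*]. *)
by rewrite -subr_ge0 (_ : _ - _ = (a * d - b * c) ^+ 2) ?sqr_ge0 //; ring.
Qed.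

Lemma normcB_ge (z w : C) : Normc.normc z - Normc.normc w <= Normc.normc (z - w).
Proof.
have /= := lerB_dist z w.
(* The norm of a complex number is itself complex; it is unfolded to the embedding of a real number,
   so that the inequality descends to [R]. *)
rewrite -[`|z|]/((Normc.normc z)%:C) -[`|w|]/((Normc.normc w)%:C).
by rewrite -[`|z - w|]/((Normc.normc (z - w))%:C) -rmorphB lecR.
Qed.

(** * States as two-by-two matrices *)

Lemma adj_mul m n l (A : 'M[C]_(m, n)) (B : 'M[C]_(n, l)) :
  adj (A *m B) = adj B *m adj A.
Proof. by rewrite /adj map_mxM trmx_mul. Qed.

Lemma adjK m n (A : 'M[C]_(m, n)) : adj (adj A) = A.
Proof. by apply/matrixP=> i j; rewrite !mxE conjcK. Qed.

Lemma adj_tens A B : adj (A *t B) = adj A *t adj B.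
Proof. by rewrite /adj map_mxT trmx_tens. Qed.

Lemma tens_mx11 : (1%:M : 'M[C]_2) *t (1%:M : 'M[C]_2) = 1%:M.
Proof.
apply/matrixP=> i j.
case: (@mxtens_indexP 2 2 i) => i1 i2; case: (@mxtens_indexP 2 2 j) => j1 j2.
rewrite tensmxE !mxE (can_eq (@mxtens_indexK 2 2)) xpair_eqE.
by case: (i1 == j1); case: (i2 == j2); rewrite /= ?mulr1 ?mulr0.
Qed.

Lemma unitary2_adj U : unitary2 U -> unitary2 (adj U).
Proof. by rewrite /unitary2 adjK => /mulmx1C. Qed.

Lemma tens_unitary U V : unitary2 U -> unitary2 V ->
  (U *t V) *m adj (U *t V) = 1%:M.
Proof. by move=> hU hV; rewrite adj_tens tensmx_mul hU hV tens_mx11. Qed.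

Lemma tens_unitaryV U V : unitary2 U -> unitary2 V ->
  adj (U *t V) *m (U *t V) = 1%:M.
Proof. by move=> hU hV; rewrite mulmx1C ?tens_unitary. Qed.

Definition vecm X : 'cV[C]_4 :=
  \col_k X (@mxtens_unindex 2 2 k).1 (@mxtens_unindex 2 2 k).2.
Definition matm psi : 'M[C]_2 :=
  \matrix_(i, j) psi (@mxtens_index 2 2 (i, j)) 0.

Lemma vecmE X i j : vecm X (@mxtens_index 2 2 (i, j)) 0 = X i j.
Proof. by rewrite mxE mxtens_indexK. Qed.

Lemma matmK : cancel matm vecm.
Proof.
move=> psi; apply/matrixP=> k j; rewrite !mxE ord1.
by rewrite -surjective_pairing mxtens_unindexK.
Qed.

Lemma vecmK : cancel vecm matm.
Proof. by move=> X; apply/matrixP=> i j; rewrite mxE vecmE. Qed.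

Lemma sum_mxtens (F : 'I_4 -> C) :
  \sum_k F k = \sum_(i < 2) \sum_(j < 2) F (@mxtens_index 2 2 (i, j)).
Proof.
rewrite pair_big /= (reindex (@mxtens_index 2 2)) /=; first by apply: eq_bigr => -[].
by exists (@mxtens_unindex 2 2) => k _; rewrite (mxtens_indexK, mxtens_unindexK).
Qed.

Lemma tens_vecm A B X : (A *t B) *m vecm X = vecm (A *m X *m B^T).
Proof.
apply/matrixP=> k j; rewrite ord1; case: (@mxtens_indexP 2 2 k) => i1 i2.
rewrite vecmE mxE sum_mxtens mxE exchange_big /=.
apply: eq_bigr => j2 _; rewrite mxE mulr_suml; apply: eq_bigr => j1 _.
by rewrite tensmxE vecmE mxE mulrAC.
Qed.

Lemma adj_vecm X Y : adj (vecm X) *m vecm Y = (\tr (adj X *m Y))%:M.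
Proof.
apply/matrixP=> i j; rewrite !ord1 mxE sum_mxtens [RHS]mxE eqxx mulr1n /mxtrace.
rewrite exchange_big; apply: eq_bigr => j1 _; rewrite mxE; apply: eq_bigr => j2 _.
by rewrite vecmE ![adj _ _ _]mxE ![map_mx _ _ _ _]mxE vecmE.
Qed.

Lemma proj_mul (W : 'M[C]_4) psi : proj (W *m psi) = W *m proj psi *m adj W.
Proof. by rewrite /proj adj_mul !mulmxA. Qed.

Lemma trace_conj (W : 'M[C]_4) (rho S : 'M[C]_4) :
  \tr ((W *m rho *m adj W) *m S) = \tr (rho *m (adj W *m S *m W)).
Proof. by rewrite -!mulmxA mxtrace_mulC !mulmxA. Qed.

Lemma trace_proj_tens X A B :
  \tr (proj (vecm X) *m (A *t B)) = \tr (adj X *m A *m X *m B^T).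
Proof.
rewrite /proj -mulmxA mxtrace_mulC -(mulmxA (adj (vecm X))).
rewrite [(A *t B : 'M_4) *m vecm X]tens_vecm.
by rewrite adj_vecm mxtrace_scalar mulr1n !mulmxA.
Qed.

Definition CHSH_diag s : 'M[C]_4 :=
  (2 / Num.sqrt (1 + s ^+ 2))%:C *:
    (s%:C *: (sigma_x R *t sigma_x R) + sigma_z R *t sigma_z R).

Definition corr_xx X : R := 2 * (dotc (X 0 0) (X 1 1) + dotc (X 0 1) (X 1 0)).
Definition corr_zz X : R :=
  sqn (X 0 0) + sqn (X 1 1) - sqn (X 0 1) - sqn (X 1 0).

Lemma trace_xx X : \tr (proj (vecm X) *m (sigma_x R *t sigma_x R)) = (corr_xx X)%:C.
Proof.
rewrite trace_proj_tens /mxtrace sum2 !mxE !sum2 !mxE !sum2 !mxE !sum2 !mxE /=.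
rewrite /corr_xx /dotc.
case: (X 0 0) (X 0 1) (X 1 0) (X 1 1) => [a b] [c d] [e f] [g h].
apply: complexP => /=; ring.
Qed.

Lemma trace_zz X : \tr (proj (vecm X) *m (sigma_z R *t sigma_z R)) = (corr_zz X)%:C.
Proof.
rewrite trace_proj_tens /mxtrace sum2 !mxE !sum2 !mxE !sum2 !mxE !sum2 !mxE /=.
rewrite /corr_zz /sqn.
case: (X 0 0) (X 0 1) (X 1 0) (X 1 1) => [a b] [c d] [e f] [g h].
apply: complexP => /=; ring.
Qed.

Lemma trace_CHSH_diag s X :
  \tr (proj (vecm X) *m CHSH_diag s) =
  (2 / Num.sqrt (1 + s ^+ 2) * (s * corr_xx X + corr_zz X))%:C.
Proof.
rewrite /CHSH_diag -scalemxAr mulmxDr -scalemxAr mxtraceZ mxtraceD mxtraceZ.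
by rewrite trace_xx trace_zz -!rmorphM -rmorphD -rmorphM.
Qed.

Lemma unit_vecE X : unit_vec (vecm X) <->
  sqn (X 0 0) + sqn (X 0 1) + sqn (X 1 0) + sqn (X 1 1) = 1.
Proof.
rewrite /unit_vec adj_vecm.
have -> : \tr (adj X *m X) =
  (sqn (X 0 0) + sqn (X 0 1) + sqn (X 1 0) + sqn (X 1 1))%:C.
  rewrite /mxtrace sum2 !mxE !sum2 !mxE /sqn /=.
  case: (X 0 0) (X 0 1) (X 1 0) (X 1 1) => [a b] [c d] [e f] [g h].
  by apply: complexP => /=; ring.
split=> [/matrixP/(_ 0 0)|->//].
by rewrite !mxE /= => -[].
Qed.

Definition concurrence X : R := 2 * Normc.normc (\det X).

Lemma det2 X : \det X = X 0 0 * X 1 1 - X 0 1 * X 1 0.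
Proof.
rewrite (expand_det_row _ 0) sum2 /cofactor !det_mx11 !mxE /= !expr0 !expr1.
rewrite mul1r mulN1r mulrN.
by congr (_ * X _ _ - _ * X _ _); apply/val_inj.
Qed.

Lemma normc_det_unitary U : unitary2 U -> Normc.normc (\det U) = 1.
Proof.
move=> /(congr1 determinant); rewrite det_mulmx det1 /adj det_tr.
rewrite (_ : \det (map_mx _ U) = (\det U)^*); last by rewrite det_map_mx.
case: (\det U) => a b [/eqP h _] /=.
apply/eqP; rewrite -(@eqrXn2 _ 2) ?sqrtr_ge0 // sqr_sqrtr ?addr_ge0 ?sqr_ge0 //.
by rewrite expr1n !expr2 -(eqP h) mulrN opprK.
Qed.

Lemma concurrence_unitary U V X : unitary2 U -> unitary2 V ->
  concurrence (U *m X *m V^T) = concurrence X.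
Proof.
move=> hU hV; rewrite /concurrence !det_mulmx det_tr !Normc.normcM.
by rewrite (normc_det_unitary hU) (normc_det_unitary hV) mul1r mulr1.
Qed.

(** * The correlation bound and its equality case *)

(** The reverse triangle inequality applied to the two terms of the determinant. *)
Lemma concurrence_ge X :
  Normc.normc (X 0 0) * Normc.normc (X 1 1) - Normc.normc (X 0 1) * Normc.normc (X 1 0)
    <= concurrence X / 2.
Proof.
rewrite /concurrence det2 mulrAC divff ?pnatr_eq0 // mul1r -!Normc.normcM.
exact: normcB_ge.
Qed.

Lemma concurrence_ge0 X : 0 <= concurrence X.
Proof. by rewrite mulr_ge0 ?normc_ge0. Qed.

(** Let a, b, c, d be the moduli of the entries 00, 11, 01, 10 and k the concurrence. Then [corr_xx]
    is at most 2 (a b + c d) <= k + 4 c d, while by normalization [corr_zz] is 1 - 2 (c^2 + d^2). As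
    s <= 1, the excess 4 s c d is absorbed by 2 (c^2 + d^2). *)
Lemma corr_le s X : unit_vec (vecm X) -> 0 <= s <= 1 ->
  s * corr_xx X + corr_zz X <= 1 + s * concurrence X.
Proof.
move=> /unit_vecE hX /andP[s0 s1]; rewrite /corr_xx /corr_zz.
have := concurrence_ge X.
have := dotc_le (X 0 0) (X 1 1); have := dotc_le (X 0 1) (X 1 0).
move: hX; rewrite !sqnE.
have := normc_ge0 (X 0 1); have := normc_ge0 (X 1 0).
move: (Normc.normc (X 0 0)) (Normc.normc (X 1 1)) => a b.
move: (Normc.normc (X 0 1)) (Normc.normc (X 1 0)) => c d.
move: (dotc _ _) (dotc _ _) (concurrence X) => x y k d0 c0 h1 hy hx hk.
have h2 : x + y <= k / 2 + 2 * (c * d) by lra.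
have h3 : s * (x + y) <= s * (k / 2 + 2 * (c * d)) by apply: ler_wpM2l.
have h4 : s * (c * d) <= c * d by apply: ler_piMl => //; apply: mulr_ge0.
have h5 : 0 <= (c - d) ^+ 2 by apply: sqr_ge0.
nra.
Qed.

(** Cauchy-Schwarz for the vectors (1, s) and (1, k). *)
Lemma cauchy_schwarz2_le s k : 0 <= 1 + s * k ->
  1 + s * k <= Num.sqrt (1 + s ^+ 2) * Num.sqrt (1 + k ^+ 2).
Proof.
move=> h; rewrite -sqrtrM ?addr_ge0 ?sqr_ge0 //.
rewrite -[leLHS]ger0_norm // -sqrtr_sqr; apply: ler_wsqrtr.
by rewrite -subr_ge0 (_ : _ - _ = (s - k) ^+ 2) ?sqr_ge0 //; ring.
Qed.

Lemma sqrt1D_gt0 s : 0 < Num.sqrt (1 + s ^+ 2).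
Proof. by rewrite sqrtr_gt0 ltr_pwDl ?sqr_ge0. Qed.

Lemma CHSH_diag_le s X : unit_vec (vecm X) -> 0 <= s <= 1 ->
  2 / Num.sqrt (1 + s ^+ 2) * (s * corr_xx X + corr_zz X)
    <= 2 * Num.sqrt (1 + concurrence X ^+ 2).
Proof.
move=> hX /[dup] hs /andP[s0 s1]; rewrite mulrAC ler_pdivrMr ?sqrt1D_gt0 //.
rewrite -mulrA ler_pM2l // mulrC [leRHS]mulrC.
apply: le_trans (cauchy_schwarz2_le _); last first.
  by rewrite addr_ge0 // mulr_ge0 // concurrence_ge0.
by rewrite mulrC; apply: corr_le.
Qed.

(** With k the concurrence, the hypothesis and [corr_le] squeeze the correlation between sqrt ((1 +
    k^2) (1 + s^2)) and 1 + s k. Squaring leaves (k - s)^2 <= 0, and the lower end becomes 1 +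
    s^2. *)
Lemma CHSH_diag_eq s X : unit_vec (vecm X) -> 0 <= s <= 1 ->
  2 * Num.sqrt (1 + concurrence X ^+ 2)
    <= 2 / Num.sqrt (1 + s ^+ 2) * (s * corr_xx X + corr_zz X) ->
  concurrence X = s /\ 1 + s ^+ 2 <= s * corr_xx X + corr_zz X.
Proof.
move=> hX /[dup] hs /andP[s0 s1]; rewrite mulrAC ler_pdivlMr ?sqrt1D_gt0 //.
rewrite -mulrA ler_pM2l // -sqrtrM ?addr_ge0 ?sqr_ge0 // => h.
have h1 := corr_le hX hs.
have h2 := le_trans h h1.
have h3 : (1 + concurrence X ^+ 2) * (1 + s ^+ 2) <= (1 + s * concurrence X) ^+ 2.
  rewrite -[leLHS]sqr_sqrtr ?mulr_ge0 ?addr_ge0 ?sqr_ge0 //.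
  by apply: lerXn2r => //; rewrite nnegrE ?sqrtr_ge0 // (le_trans _ h2) ?sqrtr_ge0.
have /eqP : (concurrence X - s) ^+ 2 == 0.
  rewrite eq_le sqr_ge0 andbT; lra.
move/eqP; rewrite sqrf_eq0 subr_eq0 => /eqP e.
split=> //; apply: le_trans h; rewrite e -expr2 sqrtr_sqr.
by rewrite ger0_norm // addr_ge0 // sqr_ge0.
Qed.

Lemma proj_vecmE X i j k l :
  proj (vecm X) (@mxtens_index 2 2 (i, j)) (@mxtens_index 2 2 (k, l))
    = X i j * (X k l)^*.
Proof. by rewrite mxE big_ord1 ![adj _ _ _]mxE ![map_mx _ _ _ _]mxE !vecmE. Qed.

(** The projector forgets the global phase: for a diagonal coefficient matrix it retains the two
    moduli and the relative phase, the latter through [X 0 0 * (X 1 1)^*]. *)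
Lemma proj_vecm_diag X Y :
  X 0 1 = 0 -> X 1 0 = 0 -> Y 0 1 = 0 -> Y 1 0 = 0 ->
  sqn (X 0 0) = sqn (Y 0 0) -> sqn (X 1 1) = sqn (Y 1 1) ->
  X 0 0 * (X 1 1)^* = Y 0 0 * (Y 1 1)^* ->
  proj (vecm X) = proj (vecm Y).
Proof.
move=> x01 x10 y01 y10 h0 h1 h01.
have h10 : X 1 1 * (X 0 0)^* = Y 1 1 * (Y 0 0)^*.
  have := congr1 (@conjc R) h01.
  by rewrite !rmorphM /= !conjcK mulrC => ->; rewrite mulrC.
apply/matrixP=> k l.
case: (@mxtens_indexP 2 2 k) => k1 k2; case: (@mxtens_indexP 2 2 l) => l1 l2.
rewrite !proj_vecmE.
case: (ord2P k1) (ord2P k2) (ord2P l1) (ord2P l2) =>-> [] -> [] -> [] ->;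
  by rewrite ?x01 ?x10 ?y01 ?y10 ?rmorph0 ?mul0r ?mulr0 ?mulc_conj ?h0 ?h1.
Qed.

(** The equality case of [corr_le]: the off-diagonal entries must vanish, and the two diagonal ones
    must have equal phases unless one of them is zero. *)
Lemma CHSH_diag_eq_coef s X : unit_vec (vecm X) -> 0 <= s <= 1 ->
  concurrence X = s -> 1 + s ^+ 2 <= s * corr_xx X + corr_zz X ->
  [/\ X 0 1 = 0, X 1 0 = 0, sqn (X 0 0) + sqn (X 1 1) = 1,
      sqn (X 0 0) * sqn (X 1 1) = s ^+ 2 / 4 & X 0 0 * (X 1 1)^* = (s / 2)%:C].
Proof.
move=> /unit_vecE hX /andP[s0 s1] eC hg.
have [c0 d0] : Normc.normc (X 0 1) = 0 /\ Normc.normc (X 1 0) = 0.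
  have := concurrence_ge X; rewrite eC.
  have := dotc_le (X 0 0) (X 1 1); have := dotc_le (X 0 1) (X 1 0).
  move: hX hg; rewrite /corr_xx /corr_zz !sqnE.
  have := normc_ge0 (X 0 1); have := normc_ge0 (X 1 0).
  move: (Normc.normc (X 0 0)) (Normc.normc (X 1 1)) => a b.
  move: (Normc.normc (X 0 1)) (Normc.normc (X 1 0)) => c d.
  move: (dotc _ _) (dotc _ _) => x y d0 c0 h1 hg hy hx hk.
  have cd0 : 0 <= c * d by apply: mulr_ge0.
  have h2 : s * (x + y) <= s * (a * b + c * d) by apply: ler_wpM2l => //; lra.
  have h3 : s * (a * b + c * d) <= s * (s / 2 + 2 * (c * d)).
    by apply: ler_wpM2l => //; lra.
  have h4 : c ^+ 2 + d ^+ 2 <= 2 * (s * (c * d)) by nra.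
  have h5 : 0 <= (c - d) ^+ 2 by apply: sqr_ge0.
  suff e : c ^+ 2 + d ^+ 2 <= 0.
    by split; apply/eqP; rewrite -sqrf_eq0 eq_le sqr_ge0 andbT;
      have := sqr_ge0 c; have := sqr_ge0 d; lra.
  (* For s < 1, [h4] gives c^2 + d^2 <= s (c^2 + d^2). At s = 1 it only gives c = d; there 2 a b <=
     a^2 + b^2 together with the normalization yields 3 (c^2 + d^2) <= 2 c d. *)
  have [s1'|s1'] := ltP s 1.
    have h6 : s * (2 * (c * d)) <= s * (c ^+ 2 + d ^+ 2) by apply: ler_wpM2l => //; lra.
    have h7 : (1 - s) * (c ^+ 2 + d ^+ 2) <= 0 by lra.
    by rewrite pmulr_rle0 in h7 => //; lra.
  have es : s = 1 by lra.
  move: h2 h3 h4 hg; rewrite es !mul1r => h2 h3 h4 hg.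
  have h6 : 0 <= (a - b) ^+ 2 by apply: sqr_ge0.
  lra.
move/Normc.eq0_normc: c0 => c0; move/Normc.eq0_normc: d0 => d0.
have sqn0 : sqn (0 : C) = 0 by rewrite /sqn /= expr0n addr0.
have e1 : sqn (X 0 0) + sqn (X 1 1) = 1.
  by move: hX; rewrite c0 d0 sqn0 !addr0.
have e2 : sqn (X 0 0) * sqn (X 1 1) = s ^+ 2 / 4.
  rewrite -eC /concurrence det2 c0 mul0r subr0 Normc.normcM !sqnE; by field.
split=> //.
move: hg e1 e2; rewrite /corr_xx /corr_zz c0 d0 sqn0.
case: (X 0 0) (X 1 1) => [a b] [c d]; rewrite /sqn /dotc /= => hg e1 e2.
(* The correlation hypothesis now reads s^2 <= 2 s (a c + b d), which is void at s = 0; in that case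
   the product of the moduli vanishes, so one of the entries does. *)
have hd : s / 2 <= a * c + b * d.
  have [s00|s00] := eqVneq s 0.
    move: e2; rewrite s00 expr0n /= mul0r => /eqP; rewrite mulf_eq0.
    by rewrite !paddr_eq0 ?sqr_ge0 // !sqrf_eq0 =>
      /orP[]/andP[/eqP-> /eqP->]; rewrite ?mul0r ?mulr0 addr0.
  have sp : 0 < s by rewrite lt_def s00.
  by rewrite -(ler_pM2l sp); lra.
(* Lagrange's identity again, now with the product of squared moduli equal to s^2 / 4. By [hd] both
   summands are nonnegative, hence zero. *)
have h0 : (a * c + b * d - s / 2) * (a * c + b * d + s / 2) + (a * d - b * c) ^+ 2 = 0.
  by transitivity ((a ^+ 2 + b ^+ 2) * (c ^+ 2 + d ^+ 2) - s ^+ 2 / 4);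
    [field | rewrite e2 subrr].
have h1 : 0 <= (a * c + b * d - s / 2) ^+ 2 by apply: sqr_ge0.
have h2 : 0 <= (a * c + b * d - s / 2) * s by apply: mulr_ge0 => //; lra.
have h3 : (a * d - b * c) ^+ 2 = 0.
  by apply/eqP; rewrite eq_le sqr_ge0 andbT; nra.
have h4 : (a * c + b * d - s / 2) ^+ 2 = 0.
  by apply/eqP; rewrite eq_le sqr_ge0 andbT; nra.
move/eqP: h3; move/eqP: h4; rewrite !sqrf_eq0 => /eqP h4 /eqP h3.
apply: complexP => /=; lra.
Qed.

Definition diag2 (p q : R) : 'M[C]_2 :=
  \matrix_(i, j) (if i == j then (if i == 0 then p else q)%:C else 0).

Lemma tens_colE (u v : 'cV[C]_2) i j :
  (u *t v : 'cV_4) (@mxtens_index 2 2 (i, j)) 0 = u i 0 * v j 0.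
Proof. by rewrite mxE mxtens_indexK; congr (u _ _ * v _ _); apply/val_inj. Qed.

Lemma vecm_diag2 (p q : R) : vecm (diag2 p q) = p%:C *: ket00 R + q%:C *: ket11 R.
Proof.
apply/matrixP=> k j; rewrite ord1; case: (@mxtens_indexP 2 2 k) => i1 i2.
rewrite vecmE [RHS]mxE [X in _ = X + _]mxE [X in _ = _ + X]mxE !tens_colE !mxE.
case: (ord2P i1) (ord2P i2) => -> [] -> /=;
  by rewrite ?mulr1 ?mulr0 ?mul0r ?addr0 ?add0r.
Qed.

(** The squared moduli of the diagonal entries have sum 1 and product s^2 / 4. So do cos^2 t and
    sin^2 t when sin 2t = s, hence the two pairs agree up to order. *)
Lemma CHSH_diag_optimal s X : unit_vec (vecm X) -> 0 <= s <= 1 ->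
  2 * Num.sqrt (1 + concurrence X ^+ 2)
    <= 2 / Num.sqrt (1 + s ^+ 2) * (s * corr_xx X + corr_zz X) ->
  let t := asin s / 2 in
  proj (vecm X) = proj (phi_cs t) \/ proj (vecm X) = proj (phi_sc t).
Proof.
move=> hX hs h t; have [eC hg] := CHSH_diag_eq hX hs h.
have [x01 x10 e1 e2 e3] := CHSH_diag_eq_coef hX hs eC hg.
have es : s = 2 * (cos t * sin t).
  have <- : sin (asin s) = s by rewrite asinK // in_itv /=; lra.
  rewrite (_ : asin s = t + t); last by rewrite /t; field.
  by rewrite sinD; ring.
have ht := cos2Dsin2 t.
have : (sqn (X 0 0) - cos t ^+ 2) * (sqn (X 0 0) - sin t ^+ 2) = 0.
  have e4 : sqn (X 0 0) * (1 - sqn (X 0 0)) = s ^+ 2 / 4.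
    by rewrite -e2 -e1 (addrC (sqn _)) addrK.
  transitivity (sqn (X 0 0) ^+ 2 - sqn (X 0 0) * (cos t ^+ 2 + sin t ^+ 2) + s ^+ 2 / 4).
    by rewrite es; field.
  by rewrite ht -e4; ring.
move=> /eqP; rewrite mulf_eq0 !subr_eq0 => /orP[]/eqP e0; [left|right].
  rewrite /phi_cs -vecm_diag2; apply: proj_vecm_diag => //; rewrite ?mxE //= ?sqn_real //.
    by lra.
  by rewrite e3 es; apply: complexP => /=; field.
rewrite /phi_sc -vecm_diag2; apply: proj_vecm_diag => //; rewrite ?mxE //= ?sqn_real //.
  by lra.
by rewrite e3 es; apply: complexP => /=; field.
Qed.

Lemma concurrence_diag2 (p q : R) : concurrence (diag2 p q) = `|2 * (p * q)|.
Proof.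
have e : \det (diag2 p q) = (p * q)%:C.
  by rewrite det2 !mxE; apply: complexP => /=; ring.
by rewrite /concurrence e /= expr0n addr0 sqrtr_sqr [RHS]normrM (ger0_norm (ler0n _ _)).
Qed.

Lemma corr_xx_diag2 (p q : R) : corr_xx (diag2 p q) = 2 * (p * q).
Proof. by rewrite /corr_xx /dotc !mxE /= !mulr0 !addr0. Qed.

Lemma corr_zz_diag2 (p q : R) : corr_zz (diag2 p q) = p ^+ 2 + q ^+ 2.
Proof. by rewrite /corr_zz !mxE /= !sqn_real /sqn /= !expr0n /= ?addr0 ?subr0. Qed.

(** No sign is imposed on [p * q]: the parameter of [CHSH_diag] may be negative, which is what
    covers angles beyond pi / 2. Only the square of the concurrence enters. *)
Lemma trace_diag2_CHSH_diag (p q : R) : p ^+ 2 + q ^+ 2 = 1 ->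
  \tr (proj (vecm (diag2 p q)) *m CHSH_diag (2 * (p * q))) =
  (2 * Num.sqrt (1 + concurrence (diag2 p q) ^+ 2))%:C.
Proof.
move=> h; rewrite trace_CHSH_diag corr_xx_diag2 corr_zz_diag2 h.
rewrite concurrence_diag2 real_normK ?num_real //.
set z := 2 * (p * q); congr (_%:C).
have h0 := sqrt1D_gt0 z.
rewrite -expr2 [z ^+ 2 + 1]addrC -{2}[1 + z ^+ 2]sqr_sqrtr ?addr_ge0 ?sqr_ge0 //.
by rewrite expr2 mulrA divfK // gt_eqF.
Qed.

(** * Schmidt decomposition *)

Lemma unitarymx_unitary2 U : U \is unitarymx -> unitary2 U.
Proof. by move=> /unitarymxP; rewrite -map_trmx. Qed.

(** The spectral theorem for the Hermitian matrix [X *m adj X]. Only one off-diagonal zero is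
    recorded: it says that the rows of [U *m X] are orthogonal. *)
Lemma unitary_diagonalize X : exists2 U, unitary2 U & (U *m (X *m adj X) *m adj U) 0 1 = 0.
Proof.
set H := X *m adj X.
have hH : adj H = H by rewrite /H adj_mul adjK.
have /orthomx_spectralP : H \is normalmx.
  apply/normalmxP; rewrite -map_trmx.
  by rewrite -[(map_mx Num.conj H)^T]/(adj H) hH.
have hP := spectral_unitarymx H.
have hU := unitarymx_unitary2 hP.
rewrite invmx_unitary // -map_trmx -[(map_mx Num.conj _)^T]/(adj (spectralmx H)).
move: hU; set P := spectralmx H; set D := spectral_diag H => hU e.
exists P => //; rewrite e !mulmxA hU mul1mx -mulmxA hU mulmx1.
by rewrite !mxE.
Qed.

Definition dotc2 (u v : 'rV[C]_2) : C := (u *m adj v) 0 0.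

Lemma dotc2E (u v : 'rV[C]_2) : dotc2 u v = u 0 0 * (v 0 0)^* + u 0 1 * (v 0 1)^*.
Proof. by rewrite /dotc2 mxE sum2 !mxE. Qed.

Definition sqn2 (u : 'rV[C]_2) : R := sqn (u 0 0) + sqn (u 0 1).

Lemma dotc2xx (u : 'rV[C]_2) : dotc2 u u = (sqn2 u)%:C.
Proof. by rewrite dotc2E !mulc_conj -rmorphD. Qed.

Lemma sqn2_ge0 (u : 'rV[C]_2) : 0 <= sqn2 u.
Proof. by rewrite addr_ge0 ?sqn_ge0. Qed.

Lemma sqn2_eq0 (u : 'rV[C]_2) : sqn2 u = 0 -> u = 0.
Proof.
move=> /eqP; rewrite /sqn2 paddr_eq0 ?sqn_ge0 // => /andP[/eqP h0 /eqP h1].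
by apply: row2P; rewrite [RHS]mxE; apply: sqn_eq0.
Qed.

Lemma dotc2Zl (k : C) (u v : 'rV[C]_2) : dotc2 (k *: u) v = k * dotc2 u v.
Proof. by rewrite !dotc2E !mxE; ring. Qed.

Lemma dotc2C (u v : 'rV[C]_2) : dotc2 u v = (dotc2 v u)^*.
Proof. by rewrite !dotc2E rmorphD !rmorphM /= !conjcK mulrC [X in _ + X]mulrC. Qed.

Lemma sqn2Z (k : R) (u : 'rV[C]_2) : sqn2 (k%:C *: u) = k ^+ 2 * sqn2 u.
Proof.
rewrite /sqn2 /sqn !mxE; case: (u 0 0) (u 0 1) => [a b] [c d] /=; ring.
Qed.

Lemma normalize2 (u : 'rV[C]_2) : u != 0 ->
  exists2 e, sqn2 e = 1 & u = (Num.sqrt (sqn2 u))%:C *: e.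
Proof.
move=> u0.
have n0 : 0 < sqn2 u.
  rewrite lt_def sqn2_ge0 andbT.
  by apply: contra u0 => /eqP/sqn2_eq0 ->.
have k0 : Num.sqrt (sqn2 u) != 0 by rewrite gt_eqF // sqrtr_gt0.
exists ((Num.sqrt (sqn2 u))^-1%:C *: u).
  by rewrite sqn2Z exprVn sqr_sqrtr ?(ltW n0) // mulVf // gt_eqF.
by rewrite scalerA -rmorphM divff // scale1r.
Qed.

Lemma orthocomplement2 (u : 'rV[C]_2) : exists2 e, sqn2 e = 1 & dotc2 e u = 0.
Proof.
have [->|u0] := eqVneq u 0.
  exists (delta_mx 0 0); last by rewrite dotc2E !mxE /= rmorph0 !mulr0 addr0.
  by rewrite /sqn2 !mxE /= /sqn /= expr0n expr1n !addr0.
(* The vector (- conj u1, conj u0) is orthogonal to u = (u0, u1) and has the same norm. *)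
pose v : 'rV[C]_2 := \row_i (if i == 0 then - (u 0 1)^* else (u 0 0)^*).
have hv : dotc2 v u = 0 by rewrite dotc2E !mxE /=; ring.
have v0 : v != 0.
  apply: contra u0 => /eqP/rowP e; apply/eqP/row2P; rewrite [RHS]mxE.
    by have := e 1; rewrite !mxE /= => /eqP; rewrite conjc_eq0 => /eqP.
  by have := e 0; rewrite !mxE /= => /eqP; rewrite oppr_eq0 conjc_eq0 => /eqP.
have [e e1 ev] := normalize2 v0; exists e => //.
move: hv; rewrite {1}ev dotc2Zl => /eqP; rewrite mulf_eq0 => /orP[|/eqP//].
move=> /eqP k0; move: ev; rewrite k0 scale0r => v00.
by rewrite v00 eqxx in v0.
Qed.

(** A zero [u] is allowed, with coefficient [sqrt 0]: then any unit vector orthogonal to [v] serves.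
    Product states, which have a vanishing Schmidt coefficient, need this case. *)
Lemma orthonormalize2_step (u v : 'rV[C]_2) : dotc2 u v = 0 ->
  exists e, [/\ sqn2 e = 1, dotc2 e v = 0 & u = (Num.sqrt (sqn2 u))%:C *: e].
Proof.
move=> huv; have [u0|u0] := eqVneq u 0.
  have [e e1 ev] := orthocomplement2 v; exists e; split=> //.
  by rewrite u0 /sqn2 !mxE /sqn /= expr0n !addr0 sqrtr0 scale0r.
have [e e1 eu] := normalize2 u0; exists e; split=> //.
move: huv; rewrite eu dotc2Zl => /eqP; rewrite mulf_eq0 => /orP[|/eqP//].
by move=> /eqP k0; move: eu u0; rewrite k0 scale0r => ->; rewrite eqxx.
Qed.

(** A singular value decomposition of the coefficient matrix X. With P diagonalizing X X^dagger, the
    rows of Y = P X are orthogonal; once normalized they are the rows of a unitary V, and Y = diag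
    (c, d) V. *)
Lemma schmidt_decomposition psi : unit_vec psi ->
  exists U V t, [/\ unitary2 U, unitary2 V, 0 <= t < pi &
    psi = (U *t V) *m phi_cs t].
Proof.
rewrite -[psi]matmK; move: (matm psi) => X hX.
have [P hP] := unitary_diagonalize X.
rewrite !mulmxA -mulmxA -adj_mul.
have [Y eY] : exists Y, Y = P *m X by exists (P *m X).
rewrite -eY => hY.
have {}hY : dotc2 (row 0 Y) (row 1 Y) = 0.
  by rewrite dotc2E ![row _ _ _ _]mxE -[RHS]hY mxE sum2 ![adj _ _ _]mxE ![map_mx _ _ _ _]mxE.
have [e0 [e01 e0r e0E]] := orthonormalize2_step hY.
have h10 : dotc2 (row 1 Y) e0 = 0 by rewrite dotc2C e0r rmorph0.
have [e1 [e11 e10 e1E]] := orthonormalize2_step h10.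
move: e0E e1E; set c := Num.sqrt (sqn2 (row 0 Y)).
set d := Num.sqrt (sqn2 (row 1 Y)) => e0E e1E.
pose V : 'M[C]_2 := \matrix_(i, j) (if i == 0 then e0 0 j else e1 0 j).
have hV : unitary2 V.
  have hd i j : (V *m adj V) i j =
    dotc2 (if i == 0 then e0 else e1) (if j == 0 then e0 else e1).
    by rewrite mxE sum2 dotc2E !mxE; case: eqP; case: eqP.
  apply: mx2P; rewrite hd /= ?dotc2xx ?e01 ?e11 ?e10 ?[dotc2 e0 e1]dotc2C ?e10 ?mxE //=.
  by rewrite oppr0.
have hYV : Y = diag2 c d *m V.
  apply/matrixP=> i j; rewrite mxE sum2 !mxE.
  have /rowP/(_ j) := e0E; have /rowP/(_ j) := e1E; rewrite !mxE.
  by case: (ord2P i) => -> /= e1j e0j; rewrite mul0r ?addr0 ?add0r.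
have hcd : c ^+ 2 + d ^+ 2 = 1.
  rewrite /c /d !sqr_sqrtr ?sqn2_ge0 //.
  have hu : unit_vec (vecm Y).
    move: hX; rewrite /unit_vec !adj_vecm eY adj_mul !mulmxA -(mulmxA (adj X)).
    by rewrite [adj P *m P]mulmx1C // mulmx1.
  by move/unit_vecE: hu => <-; rewrite /sqn2 ![row _ _ _ _]mxE; ring.
have c0 : 0 <= c by apply: sqrtr_ge0.
have d0 : 0 <= d by apply: sqrtr_ge0.
have hc1 : c <= 1 by rewrite -(@expr_le1 _ 2) // -hcd lerDl sqr_ge0.
have hc : -1 <= c <= 1 by rewrite hc1 andbT (le_trans _ c0) // oppr_le0.
have hc' : c \in `[-1, 1] by rewrite in_itv.
(* As c, d >= 0 and c^2 + d^2 = 1, the angle acos c has cosine c and sine d. The second factor acts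
   on X through its transpose, hence [V^T]. *)
exists (adj P), V^T, (acos c); split.
- exact: unitary2_adj.
- rewrite /unitary2 /adj -map_trmx trmxK.
  have := congr1 trmx (mulmx1C hV); rewrite trmx_mul trmx1 => <-.
  by rewrite /adj trmxK.
- by rewrite acos_ge0 //= acos_ltpi //; lra.
rewrite /phi_cs -vecm_diag2 tens_vecm trmxK acosK // sin_acos //.
rewrite (_ : 1 - c ^+ 2 = d ^+ 2); last by lra.
by rewrite sqrtr_sqr ger0_norm // -mulmxA -hYV eY mulmxA [adj P *m P]mulmx1C // mul1mx.
Qed.

(** * CHSH operators up to local unitaries *)

Definition dotr a b : R := a 0 0 * b 0 0 + a 0 1 * b 0 1 + a 0 2 * b 0 2.

Lemma unit3E a : unit3 a <-> dotr a a = 1.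
Proof. by rewrite /unit3 sum3 !expr2. Qed.

Lemma dot_sigmaE a : [/\ dot_sigma a 0 0 = (a 0 2)%:C,
  dot_sigma a 0 1 = a 0 0 -i* a 0 1, dot_sigma a 1 0 = a 0 0 +i* a 0 1 &
  dot_sigma a 1 1 = (- a 0 2)%:C].
Proof.
by rewrite /dot_sigma sum3; split; rewrite !mxE /=; apply: complexP => /=; ring.
Qed.

Lemma dot_sigmaD a b : dot_sigma (a + b) = dot_sigma a + dot_sigma b.
Proof.
rewrite /dot_sigma -big_split /=; apply: eq_bigr => k _.
by rewrite mxE rmorphD scalerDl.
Qed.

Lemma dot_sigmaZ (k : R) a : dot_sigma (k *: a) = k%:C *: dot_sigma a.
Proof.
rewrite /dot_sigma scaler_sumr; apply: eq_bigr => i _.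
by rewrite mxE rmorphM scalerA.
Qed.

Lemma dot_sigmaB a b : dot_sigma (a - b) = dot_sigma a - dot_sigma b.
Proof. by rewrite -scaleN1r dot_sigmaD dot_sigmaZ rmorphN1 scaleN1r. Qed.

Lemma adj_dot_sigma a : adj (dot_sigma a) = dot_sigma a.
Proof.
have [h00 h01 h10 h11] := dot_sigmaE a.
by apply: mx2P; rewrite !mxE ?h00 ?h01 ?h10 ?h11; apply: complexP => /=; ring.
Qed.

Lemma tr_dot_sigma a : \tr (dot_sigma a) = 0.
Proof.
have [h00 _ _ h11] := dot_sigmaE a.
by rewrite /mxtrace sum2 h00 h11; apply: complexP => /=; ring.
Qed.

Lemma dot_sigma_anticomm a b :
  dot_sigma a *m dot_sigma b + dot_sigma b *m dot_sigma a = (2 * dotr a b)%:C%:M.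
Proof.
have [a00 a01 a10 a11] := dot_sigmaE a; have [b00 b01 b10 b11] := dot_sigmaE b.
apply: mx2P; rewrite !mxE !sum2 /dotr ?(a00, a01, a10, a11, b00, b01, b10, b11) /=;
  by apply: complexP => /=; ring.
Qed.

Lemma dot_sigma_sqr a : dot_sigma a *m dot_sigma a = (dotr a a)%:C%:M.
Proof.
have [a00 a01 a10 a11] := dot_sigmaE a.
apply: mx2P; rewrite !mxE !sum2 /dotr ?(a00, a01, a10, a11) /=;
  by apply: complexP => /=; ring.
Qed.

(** A traceless Hermitian matrix is a real combination of the Pauli matrices, with coordinates read
    off the first column, and its square is the squared length of that vector. *)
Lemma herm_dot_sigma A : adj A = A -> \tr A = 0 -> A *m A = 1%:M ->
  exists2 a, unit3 a & A = dot_sigma a.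
Proof.
move=> hA tA AA.
pose a : 'rV[R]_3 := \row_k (if k == 0 then complex.Re (A 1 0)
  else if k == 1 then complex.Im (A 1 0) else complex.Re (A 0 0)).
have eA : A = dot_sigma a.
  have [h00 h01 h10 h11] := dot_sigmaE a.
  have := congr1 (fun M : 'M[C]_2 => M 0 0) hA.
  have := congr1 (fun M : 'M[C]_2 => M 0 1) hA.
  move: tA; rewrite /mxtrace sum2 ![adj _ _ _]mxE ![map_mx _ _ _ _]mxE => tA0 hA01 hA00.
  apply: mx2P; rewrite ?(h00, h01, h10, h11) !mxE /=.
  - by case: (A 0 0) hA00 => x y /= [h]; apply: complexP => //=; lra.
  - by rewrite -hA01; case: (A 1 0).
  - by case: (A 1 0).
  - have -> : A 1 1 = - A 0 0 by apply/eqP; rewrite -addr_eq0 addrC tA0.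
    by case: (A 0 0) hA00 => x y /= [h]; apply: complexP => //=; lra.
exists a => //; apply/unit3E; move: AA; rewrite eA dot_sigma_sqr.
by move=> /matrixP/(_ 0 0); rewrite !mxE => -[].
Qed.

(** Conjugation keeps a matrix Hermitian, traceless and of square 1, so the rotation of space
    induced by [U] never has to be written down. *)
Lemma unitary_dot_sigma U a : unitary2 U -> unit3 a ->
  exists2 a', unit3 a' & U *m dot_sigma a *m adj U = dot_sigma a'.
Proof.
move=> hU /unit3E ha.
have [|||a' ? ->] := @herm_dot_sigma (U *m dot_sigma a *m adj U); last by exists a'.
- by rewrite !adj_mul adjK adj_dot_sigma mulmxA.
- by rewrite mxtrace_mulC mulmxA (mulmx1C hU) mul1mx tr_dot_sigma.
rewrite !mulmxA -(mulmxA _ (adj U) U) (mulmx1C hU) mulmx1.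
by rewrite -(mulmxA U) dot_sigma_sqr ha mulmx1.
Qed.

Lemma tensmxZl (k : C) A B : (k *: A) *t B = k *: (A *t B).
Proof. by apply/matrixP=> i j; rewrite !mxE mulrA. Qed.

Lemma tensmxZr (k : C) A B : A *t (k *: B) = k *: (A *t B).
Proof. by apply/matrixP=> i j; rewrite !mxE mulrCA. Qed.

(** A sum of two tensors is unchanged when the same rotation mixes the left factors and the right
    factors. This is the freedom used to diagonalize a CHSH operator. *)
Lemma tens_rotation (c s : C) A A' B B' : c ^+ 2 + s ^+ 2 = 1 ->
  A *t B + A' *t B' = (c *: A + s *: A') *t (c *: B + s *: B')
    + (- s *: A + c *: A') *t (- s *: B + c *: B').
Proof.
move=> h; apply/matrixP=> i j; rewrite !mxE.
by rewrite -[LHS]mul1r -h; ring.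
Qed.

Lemma tens_conj U V A B :
  (U *t V) *m (A *t B) *m adj (U *t V) = (U *m A *m adj U) *t (V *m B *m adj V).
Proof. by rewrite adj_tens !tensmx_mul. Qed.

Lemma is_CHSH_conj U V S : unitary2 U -> unitary2 V -> is_CHSH S ->
  is_CHSH ((U *t V) *m S *m adj (U *t V)).
Proof.
move=> hU hV [a [a' [b [b' [ha ha' hb hb' ->]]]]].
have [a1 ha1 e1] := unitary_dot_sigma hU ha.
have [a1' ha1' e1'] := unitary_dot_sigma hU ha'.
have [b1 hb1 e2] := unitary_dot_sigma hV hb.
have [b1' hb1' e2'] := unitary_dot_sigma hV hb'.
exists a1, a1', b1, b1'; split=> //.
rewrite mulmxDr mulmxDl !tens_conj -e1 -e1' -e2 -e2'.
by rewrite !mulmxDr !mulmxDl !mulmxN !mulNmx.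
Qed.

Definition ex : 'rV[R]_3 := delta_mx 0 0.
Definition ez : 'rV[R]_3 := delta_mx 0 2.

Lemma dot_sigma_ex : dot_sigma ex = sigma_x R.
Proof.
have [h00 h01 h10 h11] := dot_sigmaE ex.
by apply: mx2P; rewrite ?(h00, h01, h10, h11) !mxE /=; apply: complexP => /=; ring.
Qed.

Lemma dot_sigma_ez : dot_sigma ez = sigma_z R.
Proof.
have [h00 h01 h10 h11] := dot_sigmaE ez.
by apply: mx2P; rewrite ?(h00, h01, h10, h11) !mxE /=; apply: complexP => /=; ring.
Qed.

Lemma CHSH_diag_is_CHSH s : is_CHSH (CHSH_diag s).
Proof.
pose k := (Num.sqrt (1 + s ^+ 2))^-1.
have hk : k ^+ 2 * (1 + s ^+ 2) = 1.
  rewrite /k exprVn sqr_sqrtr ?addr_ge0 ?sqr_ge0 // mulVf //.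
  by rewrite gt_eqF // ltr_pwDl ?sqr_ge0.
(* The unit vectors b and b' are (ez + s ex) and (ez - s ex) over sqrt (1 + s^2): their sum lies
   along z and their difference along x. *)
exists ez, ex, (k *: (ez + s *: ex)), (k *: (ez - s *: ex)); split.
- by apply/unit3E; rewrite /dotr !mxE /=; ring.
- by apply/unit3E; rewrite /dotr !mxE /=; ring.
- by apply/unit3E; rewrite -hk /dotr !mxE /=; ring.
- by apply/unit3E; rewrite -hk /dotr !mxE /=; ring.
rewrite -dot_sigmaD -dot_sigmaB.
have -> : k *: (ez + s *: ex) + k *: (ez - s *: ex) = (2 * k) *: ez.
  by apply/rowP=> i; rewrite !mxE; ring.
have -> : k *: (ez + s *: ex) - k *: (ez - s *: ex) = (2 * k) *: (s *: ex).
  by apply/rowP=> i; rewrite !mxE; ring.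
rewrite !dot_sigmaZ dot_sigma_ex dot_sigma_ez !tensmxZr.
by rewrite /CHSH_diag scalerDr addrC.
Qed.

Lemma dotr_ge0 a : 0 <= dotr a a.
Proof. by rewrite /dotr -!expr2 !addr_ge0 ?sqr_ge0. Qed.

Lemma row3P a b : a 0 0 = b 0 0 -> a 0 1 = b 0 1 -> a 0 2 = b 0 2 -> a = b.
Proof.
move=> h0 h1 h2; apply/rowP=> i.
have [->|[->|->]] // : i = 0 \/ i = 1 \/ i = 2.
by case: i => [[|[|[|//]]] hi]; [left|right; left|right; right]; apply/val_inj.
Qed.

Lemma dotr_eq0 a : dotr a a = 0 -> a = 0.
Proof.
move=> /eqP; rewrite /dotr -!expr2 !paddr_eq0 ?addr_ge0 ?sqr_ge0 // !sqrf_eq0.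
by move=> /andP[/andP[/eqP h0 /eqP h1] /eqP h2]; apply: row3P; rewrite [RHS]mxE.
Qed.

Lemma dotrC a b : dotr a b = dotr b a.
Proof. by rewrite /dotr; ring. Qed.

Lemma dotrZl (k : R) a b : dotr (k *: a) b = k * dotr a b.
Proof. by rewrite /dotr !mxE; ring. Qed.

Lemma dotrZr (k : R) a b : dotr a (k *: b) = k * dotr a b.
Proof. by rewrite dotrC dotrZl dotrC. Qed.

Lemma dotrDl a b p : dotr (a + b) p = dotr a p + dotr b p.
Proof. by rewrite /dotr !mxE; ring. Qed.

Lemma dotrDr a b p : dotr p (a + b) = dotr p a + dotr p b.
Proof. by rewrite dotrC dotrDl !(dotrC p). Qed.

Lemma normalize3 a : a != 0 ->
  exists2 e, dotr e e = 1 & a = Num.sqrt (dotr a a) *: e.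
Proof.
move=> a0.
have n0 : 0 < dotr a a.
  by rewrite lt_def dotr_ge0 andbT; apply: contra a0 => /eqP/dotr_eq0 ->.
have k0 : Num.sqrt (dotr a a) != 0 by rewrite gt_eqF // sqrtr_gt0.
exists ((Num.sqrt (dotr a a))^-1 *: a); last by rewrite scalerA divff // scale1r.
rewrite dotrZl dotrZr mulrA -expr2 exprVn sqr_sqrtr ?dotr_ge0 //.
by rewrite mulVf // gt_eqF.
Qed.

Lemma orthocomplement3 a : exists2 e, dotr e e = 1 & dotr e a = 0.
Proof.
pose v : 'rV[R]_3 := \row_k (if k == 0 then - a 0 1 else if k == 1 then a 0 0 else 0).
have hv : dotr v a = 0 by rewrite /dotr !mxE /=; ring.
(* [v] vanishes when [a] lies on the z axis, and then [ex] is orthogonal to it. *)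
have [v0|v0] := eqVneq v 0.
  exists ex; first by rewrite /dotr !mxE /=; ring.
  have /rowP/(_ 1) := v0; rewrite !mxE /= => a00.
  by rewrite /dotr !mxE /= a00; ring.
have [e e1 ev] := normalize3 v0; exists e => //.
move: hv; rewrite ev dotrZl => /eqP; rewrite mulf_eq0 => /orP[|/eqP//].
by move=> /eqP k0; move: ev v0; rewrite k0 scale0r => ->; rewrite eqxx.
Qed.

Lemma orthonormalize3_step p q : dotr p q = 0 ->
  exists e, [/\ dotr e e = 1, dotr e q = 0 & p = Num.sqrt (dotr p p) *: e].
Proof.
move=> hpq; have [p0|p0] := eqVneq p 0.
  have [e e1 eq] := orthocomplement3 q; exists e; split=> //.
  by rewrite p0 /dotr !mxE !mulr0 !addr0 sqrtr0 scale0r.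
have [e e1 ep] := normalize3 p0; exists e; split=> //.
move: hpq; rewrite ep dotrZl => /eqP; rewrite mulf_eq0 => /orP[|/eqP//].
by move=> /eqP k0; move: ep p0; rewrite k0 scale0r => ->; rewrite eqxx.
Qed.

Lemma orthonormalize3 p q : dotr p q = 0 ->
  exists u w, [/\ dotr u u = 1, dotr w w = 1, dotr u w = 0,
    p = Num.sqrt (dotr p p) *: u & q = Num.sqrt (dotr q q) *: w].
Proof.
move=> hpq; have [u [u1 uq ep]] := orthonormalize3_step hpq.
rewrite dotrC in uq; have [w [w1 wu eq]] := orthonormalize3_step uq.
by exists u, w; split=> //; rewrite dotrC.
Qed.

(** One Jacobi rotation. The scalar product to cancel expands to 2 al c s + be (c^2 - s^2), a
    quadratic equation for the tangent s / c. *)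
Lemma orthogonalizing_rotation p q : exists c s : R, c ^+ 2 + s ^+ 2 = 1 /\
  dotr (c *: p + s *: q) (- s *: p + c *: q) = 0.
Proof.
pose al := (dotr q q - dotr p p) / 2; pose be := dotr p q.
suff [c [s [h1 h2]]] : exists c s : R, c ^+ 2 + s ^+ 2 = 1 /\
    2 * al * (c * s) + be * (c ^+ 2 - s ^+ 2) = 0.
  exists c, s; split=> //; rewrite -h2 !(dotrDl, dotrDr, dotrZl, dotrZr).
  by rewrite (dotrC q p) /al /be; field.
have [be0|be0] := eqVneq be 0.
  by exists 1, 0; split; rewrite ?be0; ring.
(* The tangent of the angle, a root of be k^2 - 2 al k - be. *)
pose k := (al + Num.sqrt (al ^+ 2 + be ^+ 2)) / be.
have hk : be * k ^+ 2 = 2 * al * k + be.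
  have hr := @sqr_sqrtr _ (al ^+ 2 + be ^+ 2) (addr_ge0 (sqr_ge0 _) (sqr_ge0 _)).
  rewrite /k; move: hr; set r := Num.sqrt _ => hr.
  transitivity ((al ^+ 2 + 2 * al * r + r ^+ 2) / be); first by field.
  by rewrite hr; field.
have hn := sqr_sqrtr (addr_ge0 ler01 (sqr_ge0 k)).
have n0 : Num.sqrt (1 + k ^+ 2) != 0 by rewrite gt_eqF // sqrt1D_gt0.
move: hn n0; set n := Num.sqrt _ => hn n0.
exists n^-1, (k / n); split.
  transitivity ((1 + k ^+ 2) / n ^+ 2); first by field.
  by rewrite -hn divff // expf_neq0.
transitivity ((2 * al * k + be - be * k ^+ 2) / n ^+ 2); first by field.
by rewrite hk subrr mul0r.
Qed.

(** Lifts a rotation of space to a unitary of the qubit, by means of an eigenvector instead of Euler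
    angles. *)
Lemma pauli_frame u w : dotr u u = 1 -> dotr w w = 1 -> dotr u w = 0 ->
  exists U, [/\ unitary2 U, U *m sigma_z R *m adj U = dot_sigma u &
    U *m sigma_x R *m adj U = dot_sigma w].
Proof.
move=> hu hw huw.
set A := dot_sigma u; set B := dot_sigma w.
have BB : B *m B = 1%:M by rewrite dot_sigma_sqr hw.
have AB : A *m B = - (B *m A).
  by apply/eqP; rewrite -addr_eq0 dot_sigma_anticomm huw mulr0 raddf0.
have [v hv vv] : exists2 v : 'cV[C]_2, A *m v = v & adj v *m v = 1%:M.
  suff [c [n [n0 hc cc]]] : exists (c : 'cV[C]_2) (n : R),
      [/\ 0 < n, A *m c = c & adj c *m c = n%:C%:M].
    exists ((Num.sqrt n)^-1%:C *: c); first by rewrite -scalemxAr hc.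
    have -> : adj ((Num.sqrt n)^-1%:C *: c) = (Num.sqrt n)^-1%:C *: adj c.
      by apply/matrixP=> i j; rewrite !mxE rmorphM; congr (_ * _); apply: conjc_real.
    rewrite -scalemxAl -scalemxAr cc scalerA scale_scalar_mx -!rmorphM /=.
    by rewrite -expr2 exprVn sqr_sqrtr ?(ltW n0) // mulVf // gt_eqF.
  have [h00 h01 h10 h11] := dot_sigmaE u.
  have cP (x y : 'cV[C]_2) : x 0 0 = y 0 0 -> x 1 0 = y 1 0 -> x = y.
    by move=> h0 h1; apply/colP => i; case: (ord2P i) => ->.
  (* The column (1 + u_z, u_x + i u_y) is an eigenvector of [A] for 1, of squared norm 2 (1 + u_z).
     It vanishes at the south pole u_z = -1, where [A] is minus sigma_z and |1> is taken instead. *)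
  have [z1|z1] := eqVneq (u 0 2) (-1).
    have e0 : u 0 0 ^+ 2 + u 0 1 ^+ 2 = 0 by move: hu; rewrite /dotr z1; lra.
    have /andP[/eqP x0 /eqP y0] : (u 0 0 == 0) && (u 0 1 == 0).
      by move/eqP: e0; rewrite paddr_eq0 ?sqr_ge0 // !sqrf_eq0.
    exists (\col_i (if i == 0 then 0 else 1)), 1; split=> //.
      by apply: cP; rewrite !mxE sum2 !mxE ?(h00, h01, h10, h11) ?x0 ?y0 ?z1 /=;
        apply: complexP => /=; ring.
    by apply/matrixP=> i j; rewrite !ord1 !mxE sum2 !mxE /=; apply: complexP => /=; ring.
  exists (\col_i (if i == 0 then (1 + u 0 2)%:C else u 0 0 +i* u 0 1)), (2 * (1 + u 0 2)).
  have hz : u 0 0 ^+ 2 + u 0 1 ^+ 2 = (1 - u 0 2) * (1 + u 0 2).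
    by move: hu; rewrite /dotr; lra.
  split.
  - have : u 0 2 ^+ 2 <= 1 by move: hu (sqr_ge0 (u 0 0)) (sqr_ge0 (u 0 1)); rewrite /dotr; lra.
    move=> h; have : -1 <= u 0 2 by nra.
    by rewrite le_eqVlt eq_sym (negbTE z1) /=; lra.
  - apply: cP; rewrite !mxE sum2 !mxE ?(h00, h01, h10, h11) /=;
      by apply: complexP => /=; lra.
  by apply/matrixP=> i j; rewrite !ord1 !mxE sum2 !mxE /=; apply: complexP => /=; lra.
pose f0 : 'rV[C]_2 := delta_mx 0 0; pose f1 : 'rV[C]_2 := delta_mx 0 1.
have f0z : f0 *m sigma_z R = f0 by apply: row2P; rewrite !mxE sum2 !mxE /=; ring.
have f1z : f1 *m sigma_z R = - f1 by apply: row2P; rewrite !mxE sum2 !mxE /=; ring.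
have f0x : f0 *m sigma_x R = f1 by apply: row2P; rewrite !mxE sum2 !mxE /=; ring.
have f1x : f1 *m sigma_x R = f0 by apply: row2P; rewrite !mxE sum2 !mxE /=; ring.
have ff : adj f0 *m f0 + adj f1 *m f1 = 1%:M.
  by apply: mx2P; rewrite !mxE !big_ord1 !mxE /=; apply: complexP => /=; ring.
(* Since [A] fixes v and anticommutes with [B], this mean value equals its opposite. *)
have vBv : adj v *m B *m v = 0.
  have h : adj v *m B *m v = - (adj v *m B *m v).
    transitivity (adj (A *m v) *m B *m v); first by rewrite hv.
    rewrite adj_mul adj_dot_sigma -/A -(mulmxA (adj v) A B) AB mulmxN mulNmx.
    by rewrite mulmxA -(mulmxA _ A v) hv.
  apply/matrixP=> i j; rewrite [RHS]mxE.
  have : (adj v *m B *m v) i j = - (adj v *m B *m v) i j by rewrite {1}h mxE.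
  by case: ((adj v *m B *m v) i j) => x y [hx hy]; apply: complexP => /=; lra.
(* The columns of U are v and (w . sigma) v: by anticommutation they are
   eigenvectors of u . sigma for 1 and -1, and w . sigma swaps them. *)
pose U : 'M[C]_2 := v *m f0 + B *m v *m f1.
have adjD (X Y : 'M[C]_2) : adj (X + Y) = adj X + adj Y.
  by rewrite /adj map_mxD raddfD.
have hU' : adj U *m U = 1%:M.
  rewrite /U adjD !adj_mul adj_dot_sigma -/B mulmxDl !mulmxDr !mulmxA.
  rewrite -(mulmxA (adj f0)) vv mulmx1 -(mulmxA _ B B) BB mulmx1.
  rewrite -(mulmxA (adj f1) (adj v) v) vv mulmx1.
  rewrite -(mulmxA (adj f0) _ B) -(mulmxA (adj f0) _ v) vBv mulmx0 mul0mx addr0.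
  rewrite -(mulmxA (adj f1) _ B) -(mulmxA (adj f1) _ v) vBv mulmx0 mul0mx add0r.
  exact: ff.
have hU : U *m adj U = 1%:M by apply: mulmx1C.
have AU : A *m U = U *m sigma_z R.
  rewrite /U mulmxDr mulmxDl !mulmxA hv AB -!mulmxA f0z f1z mulNmx mulmxN -!mulmxA.
  by rewrite [A *m (v *m f1)]mulmxA hv mulmxN.
have BU : B *m U = U *m sigma_x R.
  by rewrite /U mulmxDr mulmxDl -!mulmxA f0x f1x [B *m (B *m _)]mulmxA BB mul1mx addrC.
exists U; split=> //.
  by rewrite -AU -mulmxA hU mulmx1.
by rewrite -BU -mulmxA hU mulmx1.
Qed.

(** The larger coefficient goes to sigma_z, so that s = be / al is at most 1. Since al^2 + be^2 = 4,
    the prefactor 2 / sqrt (1 + s^2) is al. *)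
Lemma CHSH_diag_frame (al be : R) u u' w w' :
  0 <= be <= al -> al ^+ 2 + be ^+ 2 = 4 ->
  dotr u u = 1 -> dotr w w = 1 -> dotr u w = 0 ->
  dotr u' u' = 1 -> dotr w' w' = 1 -> dotr u' w' = 0 ->
  exists U V s, [/\ unitary2 U, unitary2 V, 0 <= s <= 1 &
    al%:C *: (dot_sigma u *t dot_sigma u') + be%:C *: (dot_sigma w *t dot_sigma w')
    = (U *t V) *m CHSH_diag s *m adj (U *t V)].
Proof.
move=> /andP[be0 hab] hn hu hw huw hu' hw' huw'.
have [U [hU Uz Ux]] := pauli_frame hu hw huw.
have [V [hV Vz Vx]] := pauli_frame hu' hw' huw'.
have al0 : 0 < al.
  rewrite lt_def (le_trans be0 hab) andbT; apply/eqP => e.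
  have b0 : be = 0 by apply/eqP; rewrite eq_le be0 andbT -e.
  by move: hn; rewrite e b0; lra.
exists U, V, (be / al); split=> //.
  by rewrite divr_ge0 ?(ltW al0) //= ler_pdivrMr // mul1r.
have -> : CHSH_diag (be / al) =
  be%:C *: (sigma_x R *t sigma_x R) + al%:C *: (sigma_z R *t sigma_z R).
  have -> : be = al * (be / al) by rewrite mulrC divfK // gt_eqF.
  rewrite [in RHS]rmorphM -scalerA -scalerDr.
  rewrite (_ : al * (be / al) / al = be / al); last by rewrite mulrCA divff ?mulr1 // gt_eqF.
  congr (_%:C *: _).
  rewrite (_ : 1 + (be / al) ^+ 2 = (2 / al) ^+ 2).
    by rewrite sqrtr_sqr ger0_norm ?divr_ge0 ?(ltW al0) //; field; rewrite gt_eqF.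
  have al00 : al != 0 by rewrite gt_eqF.
  transitivity ((al ^+ 2 + be ^+ 2) / al ^+ 2); first by field.
  by rewrite hn; field.
rewrite mulmxDr mulmxDl -!scalemxAr -!scalemxAl !tens_conj Uz Ux Vz Vx.
by rewrite addrC.
Qed.

(** As b and b' are unit vectors, b + b' and b - b' are orthogonal, with squared norms adding up to
    4. Hence S is mu a (x) u0 + nu a' (x) w0 with u0, w0 orthonormal, and a rotation of both pairs
    makes the left vectors orthogonal as well. *)
Lemma CHSH_normal_form S : is_CHSH S ->
  exists U V s, [/\ unitary2 U, unitary2 V, 0 <= s <= 1 &
    S = (U *t V) *m CHSH_diag s *m adj (U *t V)].
Proof.
move=> [a [a' [b [b' [/unit3E ha /unit3E ha' /unit3E hb /unit3E hb' ->]]]]].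
rewrite -dot_sigmaD -dot_sigmaB.
have h0 : dotr (b + b') (b - b') = 0.
  by rewrite -scaleN1r !(dotrDl, dotrDr, dotrZl, dotrZr) (dotrC b') hb hb'; ring.
have hn0 : dotr (b + b') (b + b') + dotr (b - b') (b - b') = 4.
  by rewrite -scaleN1r !(dotrDl, dotrDr, dotrZl, dotrZr) (dotrC b') hb hb'; ring.
have [u0 [w0 [hu0 hw0 huw0]]] := orthonormalize3 h0.
set mu := Num.sqrt _; set nu := Num.sqrt _ => -> ->.
have hmn : mu ^+ 2 + nu ^+ 2 = 4 by rewrite !sqr_sqrtr ?dotr_ge0.
have [c [s [hcs hpq]]] := orthogonalizing_rotation (mu *: a) (nu *: a').
set p := _ + _ in hpq; set q := _ + _ in hpq.
pose u1 := c *: u0 + s *: w0; pose w1 := - s *: u0 + c *: w0.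
have hu1 : dotr u1 u1 = 1.
  by rewrite -hcs !(dotrDl, dotrDr, dotrZl, dotrZr) (dotrC w0) hu0 hw0 huw0; ring.
have hw1 : dotr w1 w1 = 1.
  by rewrite -hcs !(dotrDl, dotrDr, dotrZl, dotrZr) (dotrC w0) hu0 hw0 huw0; ring.
have huw1 : dotr u1 w1 = 0.
  by rewrite !(dotrDl, dotrDr, dotrZl, dotrZr) (dotrC w0) hu0 hw0 huw0; ring.
(* A rotation preserves the sum of the squared norms of the pair, here mu^2 + nu^2. *)
have hn1 : dotr p p + dotr q q = 4.
  transitivity ((c ^+ 2 + s ^+ 2) * (mu ^+ 2 + nu ^+ 2)); last by rewrite hcs hmn mul1r.
  by rewrite !(dotrDl, dotrDr, dotrZl, dotrZr) (dotrC a') ha ha'; ring.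
have -> : dot_sigma a *t dot_sigma (mu *: u0) + dot_sigma a' *t dot_sigma (nu *: w0) =
  dot_sigma p *t dot_sigma u1 + dot_sigma q *t dot_sigma w1.
  rewrite [dot_sigma (mu *: u0)]dot_sigmaZ [dot_sigma (nu *: w0)]dot_sigmaZ.
  rewrite !tensmxZr -!tensmxZl -!dot_sigmaZ.
  rewrite /p /q /u1 /w1 !dot_sigmaD ![dot_sigma (c *: _)]dot_sigmaZ.
  rewrite ![dot_sigma (s *: _)]dot_sigmaZ ![dot_sigma (- s *: _)]dot_sigmaZ rmorphN.
  by apply: tens_rotation; rewrite -!rmorphXn -rmorphD hcs.
have [u2 [w2 [hu2 hw2 huw2]]] := orthonormalize3 hpq.
move: hn1; set al := Num.sqrt (dotr p p); set be := Num.sqrt (dotr q q) => hn1 -> ->.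
have hab : al ^+ 2 + be ^+ 2 = 4 by rewrite !sqr_sqrtr ?dotr_ge0.
rewrite !dot_sigmaZ !tensmxZl.
(* The two terms are exchanged if needed, so that the larger coefficient comes first. *)
have [hle|/ltW hle] := leP be al.
  by apply: CHSH_diag_frame => //; rewrite hle sqrtr_ge0.
rewrite addrC; apply: CHSH_diag_frame => //; rewrite 1?dotrC ?hle ?sqrtr_ge0 //.
by rewrite addrC.
Qed.

(** * Optimal CHSH operators *)

Lemma tens_conjK U V S : unitary2 U -> unitary2 V ->
  adj (U *t V) *m ((U *t V) *m S *m adj (U *t V)) *m (U *t V) = S.
Proof.
move=> hU hV; have hW := tens_unitaryV hU hV.
by rewrite !mulmxA hW mul1mx -mulmxA hW mulmx1.
Qed.

(** A competitor for the rotated state is pulled back by the inverse local unitaries, which again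
    gives a CHSH operator. *)
Lemma optimal_CHSH_conj U V rho S : unitary2 U -> unitary2 V ->
  optimal_CHSH rho S ->
  optimal_CHSH ((U *t V) *m rho *m adj (U *t V)) ((U *t V) *m S *m adj (U *t V)).
Proof.
move=> hU hV [hS hmax]; split; first exact: is_CHSH_conj.
have haW := adj_tens U V.
move=> S' hS'; rewrite !trace_conj [X in _ <= \tr (_ *m X)]tens_conjK //.
apply: hmax; have := is_CHSH_conj (unitary2_adj hU) (unitary2_adj hV) hS'.
by rewrite -haW adjK.
Qed.

Lemma unit_vec_tens U V psi : unitary2 U -> unitary2 V -> unit_vec psi ->
  unit_vec ((U *t V) *m psi).
Proof.
move=> hU hV; rewrite /unit_vec adj_mul => h.
by rewrite mulmxA -(mulmxA (adj psi)) (tens_unitaryV hU hV) mulmx1.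
Qed.

(** The unitaries of the normal form of S are moved onto the state, which does not change its
    concurrence. *)
Lemma CHSH_le X S : unit_vec (vecm X) -> is_CHSH S ->
  \tr (proj (vecm X) *m S) <= (2 * Num.sqrt (1 + concurrence X ^+ 2))%:C.
Proof.
move=> hX /CHSH_normal_form[U [V [s [hU hV hs ->]]]].
have hU' := unitary2_adj hU; have hV' := unitary2_adj hV.
have -> : \tr (proj (vecm X) *m ((U *t V) *m CHSH_diag s *m adj (U *t V)))
  = \tr (proj ((adj U *t adj V) *m vecm X) *m CHSH_diag s).
  by rewrite proj_mul trace_conj -adj_tens adjK.
have := unit_vec_tens hU' hV' hX.
rewrite tens_vecm -(concurrence_unitary X hU' hV') => hY.
by rewrite trace_CHSH_diag lecR; apply: CHSH_diag_le.
Qed.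

Lemma optimal_diag2 (p q : R) : p ^+ 2 + q ^+ 2 = 1 ->
  optimal_CHSH (proj (vecm (diag2 p q))) (CHSH_diag (2 * (p * q))).
Proof.
move=> h; split=> [|S hS]; first exact: CHSH_diag_is_CHSH.
rewrite trace_diag2_CHSH_diag //; apply: CHSH_le => //.
by apply/unit_vecE; rewrite -h !mxE /= !sqn_real /sqn /=; ring.
Qed.

Lemma sin2 t : sin (2 * t) = 2 * (cos t * sin t).
Proof. by rewrite (_ : 2 * t = t + t) ?sinD; ring. Qed.

Lemma optimal_phi_cs t : optimal_CHSH (proj (phi_cs t)) (S_plus t).
Proof.
rewrite -[S_plus t]/(CHSH_diag (sin (2 * t))) sin2 /phi_cs -vecm_diag2.
by apply: optimal_diag2; rewrite cos2Dsin2.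
Qed.

Lemma optimal_phi_sc t : optimal_CHSH (proj (phi_sc t)) (S_plus t).
Proof.
rewrite -[S_plus t]/(CHSH_diag (sin (2 * t))) sin2 [cos t * _]mulrC /phi_sc -vecm_diag2.
by apply: optimal_diag2; rewrite addrC cos2Dsin2.
Qed.

(** The competitor is the diagonal operator adapted to the Schmidt coefficients of X, conjugated by
    the Schmidt unitaries; it attains the bound of [CHSH_le]. *)
Lemma optimal_CHSH_ge X S : unit_vec (vecm X) -> optimal_CHSH (proj (vecm X)) S ->
  (2 * Num.sqrt (1 + concurrence X ^+ 2))%:C <= \tr (proj (vecm X) *m S).
Proof.
move=> hX [_ hmax]; have [U [V [t [hU hV _ eX]]]] := schmidt_decomposition hX.
have := hmax _ (is_CHSH_conj hU hV (CHSH_diag_is_CHSH (2 * (cos t * sin t)))).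
apply: le_trans; rewrite eX proj_mul trace_conj.
rewrite tens_conjK //.
rewrite /phi_cs -vecm_diag2 trace_diag2_CHSH_diag ?cos2Dsin2 //.
have -> : X = U *m diag2 (cos t) (sin t) *m V^T.
  apply: (can_inj (vecmK)).
  by rewrite -tens_vecm eX /phi_cs -vecm_diag2.
by rewrite concurrence_unitary.
Qed.

Definition phase_gate : 'M[C]_2 :=
  \matrix_(i, j) (if i == j then (if i == 0 then 1 else 'i) else 0).

Lemma phase_gate_unitary : unitary2 phase_gate.
Proof. by apply: mx2P; rewrite !mxE !sum2 !mxE /=; apply: complexP => /=; ring. Qed.

(** The phases i and -i that the two sides put on |11> cancel. *)
Lemma phase_gate_vecm_diag2 (p q : R) :
  (phase_gate *t adj phase_gate) *m vecm (diag2 p q) = vecm (diag2 p q).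
Proof.
rewrite tens_vecm; congr vecm.
by apply: mx2P; rewrite !mxE !sum2 !mxE /= !sum2 !mxE /=; apply: complexP => /=; ring.
Qed.

(** The gate turns sigma_x into sigma_y on the left and its adjoint turns it into - sigma_y on the
    right, whence the minus sign; sigma_z is fixed. *)
Lemma S_minusE t :
  S_minus t = (phase_gate *t adj phase_gate) *m S_plus t
              *m adj (phase_gate *t adj phase_gate).
Proof.
have ex1 : phase_gate *m sigma_x R *m adj phase_gate = sigma_y R.
  by apply: mx2P; rewrite !mxE !sum2 !mxE /= !sum2 !mxE /=; apply: complexP => /=; ring.
have ex2 : adj phase_gate *m sigma_x R *m phase_gate = - 1 *: sigma_y R.
  by apply: mx2P; rewrite !mxE !sum2 !mxE /= !sum2 !mxE /=; apply: complexP => /=; ring.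
have ez1 : phase_gate *m sigma_z R *m adj phase_gate = sigma_z R.
  by apply: mx2P; rewrite !mxE !sum2 !mxE /= !sum2 !mxE /=; apply: complexP => /=; ring.
have ez2 : adj phase_gate *m sigma_z R *m phase_gate = sigma_z R.
  by apply: mx2P; rewrite !mxE !sum2 !mxE /= !sum2 !mxE /=; apply: complexP => /=; ring.
rewrite /S_plus -scalemxAr -scalemxAl mulmxDr mulmxDl -scalemxAr -scalemxAl.
rewrite !tens_conj adjK ex1 ex2 ez1 ez2 tensmxZr scalerA mulrN1.
by [].
Qed.

Lemma optimal_phi_cs_minus t : optimal_CHSH (proj (phi_cs t)) (S_minus t).
Proof.
have hP := phase_gate_unitary.
have := optimal_CHSH_conj hP (unitary2_adj hP) (optimal_phi_cs t).
by rewrite -proj_mul -S_minusE /phi_cs -vecm_diag2 phase_gate_vecm_diag2.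
Qed.

Lemma optimal_phi_sc_minus t : optimal_CHSH (proj (phi_sc t)) (S_minus t).
Proof.
have hP := phase_gate_unitary.
have := optimal_CHSH_conj hP (unitary2_adj hP) (optimal_phi_sc t).
by rewrite -proj_mul -S_minusE /phi_sc -vecm_diag2 phase_gate_vecm_diag2.
Qed.

Lemma optimal_CHSH_diag_proj s psi : unit_vec psi -> 0 <= s <= 1 ->
  optimal_CHSH (proj psi) (CHSH_diag s) ->
  let t := asin s / 2 in proj psi = proj (phi_cs t) \/ proj psi = proj (phi_sc t).
Proof.
rewrite -[psi]matmK => hX hs /(optimal_CHSH_ge hX).
by rewrite trace_CHSH_diag lecR; apply: CHSH_diag_optimal.
Qed.

Lemma phi_cs_compl t : phi_cs (pi / 2 - t) = phi_sc t.
Proof.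
by rewrite /phi_cs /phi_sc cosB sinB cos_pihalf sin_pihalf !mul0r !mul1r add0r subr0.
Qed.

Lemma phi_sc_compl t : phi_sc (pi / 2 - t) = phi_cs t.
Proof.
by rewrite /phi_cs /phi_sc cosB sinB cos_pihalf sin_pihalf !mul0r !mul1r add0r subr0.
Qed.

Lemma optimal_S_plus_minus psi psi' U V t : unitary2 U -> unitary2 V ->
  proj psi = (U *t V) *m proj (phi_cs t) *m adj (U *t V) ->
  proj psi' = (U *t V) *m proj (phi_sc t) *m adj (U *t V) ->
  [/\ optimal_CHSH (proj psi) ((U *t V) *m S_plus t *m adj (U *t V)),
      optimal_CHSH (proj psi') ((U *t V) *m S_plus t *m adj (U *t V)),
      optimal_CHSH (proj psi) ((U *t V) *m S_minus t *m adj (U *t V))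
    & optimal_CHSH (proj psi') ((U *t V) *m S_minus t *m adj (U *t V))].
Proof.
move=> hU hV -> ->; split; apply: optimal_CHSH_conj => //.
- exact: optimal_phi_cs.
- exact: optimal_phi_sc.
- exact: optimal_phi_cs_minus.
- exact: optimal_phi_sc_minus.
Qed.

End CHSH.

(** States are compared through their projectors, that is, up to a global phase. *)
Theorem theorem2 (R : realType) (psi psi' : 'cV[R[i]]_4) :
  unit_vec psi -> unit_vec psi' -> proj psi <> proj psi' ->
  (same_optimal_CHSH (proj psi) (proj psi') <->
     exists (UA UB : 'M[R[i]]_2) (t : R),
       [/\ unitary2 UA, unitary2 UB, 0 <= t < pi,
           proj psi = (UA *t UB) *m proj (phi_cs t) *m adj (UA *t UB)
         & proj psi' = (UA *t UB) *m proj (phi_sc t) *m adj (UA *t UB)])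
  /\
  (forall (UA UB : 'M[R[i]]_2) (t : R),
     unitary2 UA -> unitary2 UB -> 0 <= t < pi ->
     proj psi = (UA *t UB) *m proj (phi_cs t) *m adj (UA *t UB) ->
     proj psi' = (UA *t UB) *m proj (phi_sc t) *m adj (UA *t UB) ->
     [/\ optimal_CHSH (proj psi) ((UA *t UB) *m S_plus t *m adj (UA *t UB)),
         optimal_CHSH (proj psi') ((UA *t UB) *m S_plus t *m adj (UA *t UB)),
         optimal_CHSH (proj psi) ((UA *t UB) *m S_minus t *m adj (UA *t UB))
       & optimal_CHSH (proj psi') ((UA *t UB) *m S_minus t *m adj (UA *t UB))]).
Proof.
move=> hpsi hpsi' hne.
have opt UA UB t hU hV (_ : 0 <= t < pi) := @optimal_S_plus_minus R psi psi' UA UB t hU hV.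
split; last exact: opt.
split; last first.
  move=> [U [V [t [hU hV ht e e']]]]; have [h1 h2 _ _] := opt U V t hU hV ht e e'.
  by exists ((U *t V) *m S_plus t *m adj (U *t V)).
move=> [S [hS hS']].
have [U [V [s [hU hV hs eS]]]] := CHSH_normal_form (proj1 hS).
have hU' := unitary2_adj hU; have hV' := unitary2_adj hV.
have hW := tens_unitary hU hV;
have eW := adj_tens U V.
(* In the frame where S is diagonal, optimality leaves two candidates. They depend on s only, so
   they are the same for both states. *)
have key phi : unit_vec phi -> optimal_CHSH (proj phi) S ->
  let t := asin s / 2 in
  proj phi = (U *t V) *m proj (phi_cs t) *m adj (U *t V) \/
  proj phi = (U *t V) *m proj (phi_sc t) *m adj (U *t V).
  move=> hphi /(optimal_CHSH_conj hU' hV').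
  rewrite -proj_mul eS -eW adjK tens_conjK //.
  move=> hopt t.
  have hu : unit_vec (adj (U *t V) *m phi) by rewrite eW; apply: unit_vec_tens.
  have e : proj phi = (U *t V) *m proj (adj (U *t V) *m phi) *m adj (U *t V).
    by rewrite -proj_mul mulmxA hW mul1mx.
  by have [h|h] := optimal_CHSH_diag_proj hu hs hopt; rewrite h in e; [left|right]; exact: e.
(* This range keeps both t and pi / 2 - t inside [0, pi); either may be needed as the angle. *)
have /andP[t0 t1] : 0 <= asin s / 2 <= pi / 4.
  have /andP[s0 s1] := hs.
  have hs' : -1 <= s <= 1 by lra.
  have := asin_lepi2 hs'.
  have : 0 <= asin s.
    rewrite leNgt; apply/negP => hneg.
    have := asin_geNpi2 hs' => hge.
    have : sin (asin s) < 0.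
      rewrite -oppr_gt0 -sinN; apply: sin_gt0_pi; have := pi_gt0 R; lra.
    by rewrite asinK ?in_itv //= ltNge s0.
  lra.
have p0 := pi_gt0 R.
have := key _ hpsi hS; have := key _ hpsi' hS'; move: t0 t1.
move: (asin s / 2) => t t0 t1 /= [] e' [] e.
- by case: hne; exact: etrans e (esym e').
(* The states occur in the reverse order; replacing t by pi / 2 - t exchanges cosine and sine. *)
- rewrite -phi_cs_compl in e; rewrite -phi_sc_compl in e'.
  exists U, V, (pi / 2 - t); split; [exact: hU|exact: hV| |exact: e|exact: e'].
  by apply/andP; split; lra.
- exists U, V, t; split; [exact: hU|exact: hV| |exact: e|exact: e'].
  by apply/andP; split; lra.
- by case: hne; exact: etrans e (esym e').
Qed.
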